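(* We have (a) $$\frac{1}{1-t}+\frac{1}{1+y}\sum_{n=1}^\infty\left(\frac{1+yt}{1-t}\right)^{n+1}P_n^{(\mathrm{pk},\mathrm{des},\mathrm{fix})}\left(\frac{(1+y)^2t}{(y+t)(1+yt)},\frac{y+t}{1+yt},z\right)x^n=\sum_{k=0}^\infty\frac{(1+zxy)^k}{(1-zx)^k}\frac{(1-x)^k}{(1+xy)^k}\frac{t^k}{1-k(1+y)x}$$ and (b) $$\frac{1}{1-t}+\frac{1}{1+y}\sum_{n=1}^\infty\left(\frac{1+yt}{1-t}\right)^{n+1}D_n^{(\mathrm{pk},\mathrm{des})}\left(\frac{(1+y)^2t}{(y+t)(1+yt)},\frac{y+t}{1+yt}\right)x^n=\sum_{k=0}^\infty\frac{(1-x)^k}{(1+xy)^k}\frac{t^k}{1-k(1+y)x}.$$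
   Context: For a permutation $\pi=\pi(1)\cdots\pi(n)$ of $[n]=\{1,\dots,n\}$, $\mathrm{des}(\pi)$ is the number of descents, i.e. $i\in[n-1]$ with $\pi(i)>\pi(i+1)$; $\mathrm{pk}(\pi)$ is the number of peaks, i.e. $i\in\{2,\dots,n-1\}$ with $\pi(i-1)<\pi(i)>\pi(i+1)$; $\mathrm{fix}(\pi)$ is the number of fixed points. $\mathfrak{S}_n$ is the set of all permutations of $[n]$ and $\mathfrak{D}_n$ is the set of derangements of $[n]$ (permutations with no fixed points). Put $$P_n^{(\mathrm{pk},\mathrm{des},\mathrm{fix})}(y,t,z)=\sum_{\pi\in\mathfrak{S}_n}y^{\mathrm{pk}(\pi)+1}t^{\mathrm{des}(\pi)+1}z^{\mathrm{fix}(\pi)},\qquad D_n^{(\mathrm{pk},\mathrm{des})}(y,t)=\sum_{\pi\in\mathfrak{D}_n}y^{\mathrm{pk}(\pi)+1}t^{\mathrm{des}(\pi)+1}.$$ The identities are between formal power series in $x$ and $t$; rational functions of $y,t$ are expanded as power series in $t$. *)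

(* Defs.v *)
From HB Require Import structures.
From mathcomp Require Import all_boot all_order all_algebra perm.
From mathcomp Require Import boolp.

Set Implicit Arguments.
Unset Strict Implicit.
Unset Printing Implicit Defensive.

Import GRing.Theory.
Local Open Scope ring_scope.

(* Formal power series R[[X]], as a comUnitRingType when R is one.  The units *)
(* are the series with invertible constant coefficient, so that f / g has its *)
(* usual meaning (expansion as a power series) for such a g.                  *)

Record fps (R : Type) := Fps { fps_coef : nat -> R }.

Notation "{ 'fps' R }" := (fps R) (at level 0, format "{ 'fps'  R }").

HB.instance Definition _ (R : Type) := gen_eqMixin {fps R}.
HB.instance Definition _ (R : Type) := gen_choiceMixin {fps R}.

Lemma fpsP (R : Type) (f g : {fps R}) : fps_coef f =1 fps_coef g -> f = g.
Proof. by case: f g => [f] [g] /= /funext ->. Qed.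

Section FpsZmodule.
Variable R : zmodType.
Implicit Types f g h : {fps R}.

Definition fps_zero : {fps R} := Fps (fun=> 0).
Definition fps_opp f : {fps R} := Fps (fun n => - fps_coef f n).
Definition fps_add f g : {fps R} := Fps (fun n => fps_coef f n + fps_coef g n).

Fact fps_addA : associative fps_add.
Proof. by move=> f g h; apply: fpsP => n /=; rewrite addrA. Qed.
Fact fps_addC : commutative fps_add.
Proof. by move=> f g; apply: fpsP => n /=; rewrite addrC. Qed.
Fact fps_add0 : left_id fps_zero fps_add.
Proof. by move=> f; apply: fpsP => n /=; rewrite add0r. Qed.
Fact fps_addN : left_inverse fps_zero fps_opp fps_add.
Proof. by move=> f; apply: fpsP => n /=; rewrite addNr. Qed.

HB.instance Definition _ :=
  GRing.isZmodule.Build {fps R} fps_addA fps_addC fps_add0 fps_addN.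

Lemma fps_coef0 n : fps_coef (0 : {fps R}) n = 0. Proof. by []. Qed.
Lemma fps_coefD f g n : fps_coef (f + g) n = fps_coef f n + fps_coef g n.
Proof. by []. Qed.
Lemma fps_coefN f n : fps_coef (- f) n = - fps_coef f n. Proof. by []. Qed.

Lemma fps_coef_sum I (r : seq I) (P : pred I) (F : I -> {fps R}) n :
  fps_coef (\sum_(i <- r | P i) F i) n = \sum_(i <- r | P i) fps_coef (F i) n.
Proof. exact: (big_morph (fun f => fps_coef f n)). Qed.

End FpsZmodule.

Section FpsRing.
Variable R : comNzRingType.
Implicit Types f g h : {fps R}.

Definition fpsC (a : R) : {fps R} := Fps (fun n => if n == 0 then a else 0).
Definition fpsX : {fps R} := Fps (fun n => (n == 1)%:R).

Definition fps_mul f g : {fps R} :=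
  Fps (fun n => \sum_(i < n.+1) fps_coef f i * fps_coef g (n - i)).

Definition fps_trunc n f : {poly R} := \poly_(i < n.+1) fps_coef f i.

Lemma fps_truncE n f i : (i <= n)%N -> (fps_trunc n f)`_i = fps_coef f i.
Proof. by move=> le_in; rewrite coef_poly ltnS le_in. Qed.

Lemma fps_mulE n f g i : (i <= n)%N ->
  fps_coef (fps_mul f g) i = (fps_trunc n f * fps_trunc n g)`_i.
Proof.
move=> le_in; rewrite coefM /=; apply: eq_bigr => j _.
have le_ji : (j <= i)%N by rewrite -ltnS.
by rewrite !fps_truncE // ?(leq_trans le_ji) // (leq_trans (leq_subr _ _)).
Qed.

Fact fps_mulC : commutative fps_mul.
Proof. by move=> f g; apply: fpsP => n; rewrite !(@fps_mulE n) // mulrC. Qed.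

Fact fps_mulA : associative fps_mul.
Proof.
move=> f g h; apply: fpsP => n.
have eL : fps_coef (fps_mul f (fps_mul g h)) n =
    (fps_trunc n f * (fps_trunc n g * fps_trunc n h))`_n.
  rewrite (@fps_mulE n) // !coefM; apply: eq_bigr => i _; congr (_ * _).
  by rewrite fps_truncE ?leq_subr // (@fps_mulE n) ?leq_subr.
rewrite eL (@fps_mulE n) // mulrA !coefM; apply: eq_bigr => i _.
have le_in : (i <= n)%N by rewrite -ltnS.
by congr (_ * _); rewrite fps_truncE // (@fps_mulE n).
Qed.

Fact fps_mul1 : left_id (fpsC 1) fps_mul.
Proof.
move=> f; apply: fpsP => n /=.
rewrite big_ord_recl /= mul1r subn0 big1 ?addr0 // => i _.
by rewrite mul0r.
Qed.

Fact fps_mulDl : left_distributive fps_mul (@fps_add R).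
Proof.
move=> f g h; apply: fpsP => n /=.
by rewrite -big_split /=; apply: eq_bigr => i _; rewrite mulrDl.
Qed.

Fact fps_1neq0 : fpsC 1 != 0.
Proof.
apply/eqP => /(congr1 (fun f => fps_coef f 0)) /= /eqP.
by rewrite oner_eq0.
Qed.

HB.instance Definition _ := GRing.Zmodule_isComNzRing.Build {fps R}
  fps_mulA fps_mulC fps_mul1 fps_mulDl fps_1neq0.

Lemma fps_coefM f g n :
  fps_coef (f * g) n = \sum_(i < n.+1) fps_coef f i * fps_coef g (n - i).
Proof. by []. Qed.

Lemma fps_coef1 n : fps_coef (1 : {fps R}) n = (n == 0)%:R.
Proof. by rewrite /=; case: eqP. Qed.

Lemma fps_coef0M f g : fps_coef (f * g) 0 = fps_coef f 0 * fps_coef g 0.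
Proof. by rewrite fps_coefM big_ord_recl big_ord0 addr0. Qed.

Lemma fps_coef_exp_lt f n i :
  fps_coef f 0 = 0 -> (i < n)%N -> fps_coef (f ^+ n) i = 0.
Proof.
move=> f0; elim: n i => [//|n IHn] i lt_in.
rewrite exprS fps_coefM big1 // => -[[|j] lt_ji] _ /=; first by rewrite f0 mul0r.
rewrite IHn ?mulr0 //; rewrite ltnS in lt_in lt_ji.
by rewrite ltn_subLR // addSn ltnS (leq_trans lt_in) ?leq_addl.
Qed.

End FpsRing.

Section FpsUnitRing.
Variable R : comUnitRingType.
Implicit Types f g h : {fps R}.

Definition fps_unit : {pred {fps R}} :=
  [pred f | fps_coef f 0 \is a GRing.unit].

(* Geometric series: with h = 1 - f / f(0), which has no constant term,       *)
(* 1 / f = f(0)^-1 * \sum_k h ^+ k, and h ^+ k contributes to the coefficient *)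
(* of X^n only for k <= n.                                                    *)
Definition fps_inv f : {fps R} :=
  if f \in fps_unit then
    fpsC (fps_coef f 0)^-1 *
    Fps (fun n => \sum_(k < n.+1)
           fps_coef ((1 - fpsC (fps_coef f 0)^-1 * f) ^+ k) n)
  else f.

Fact fps_mulVf : {in fps_unit, left_inverse 1 fps_inv *%R}.
Proof.
move=> f Uf; rewrite /fps_inv Uf; move: Uf; rewrite inE => Uf.
set c := fpsC _; set h := 1 - c * f; set s := Fps _.
have h0 : fps_coef h 0 = 0.
  by rewrite fps_coefD fps_coefN fps_coef0M /= mulVr // subrr.
have -> : c * s * f = s * (1 - h) by rewrite opprB addrC subrK mulrCA mulrA.
apply: fpsP => n; rewrite fps_coefM.
transitivity (fps_coef ((\sum_(k < n.+1) h ^+ k) * (1 - h)) n).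
  rewrite fps_coefM; apply: eq_bigr => i _; congr (_ * _).
  rewrite fps_coef_sum /= -!(big_mkord xpredT (fun k => fps_coef (h ^+ k) i)).
  rewrite (@big_cat_nat _ _ _ i.+1 0%N n.+1) //=.
  rewrite [X in _ = _ + X]big_nat_cond [X in _ = _ + X]big1 ?addr0 //.
  by move=> k /andP[/andP[lt_ik _] _]; apply: fps_coef_exp_lt.
have -> : (\sum_(k < n.+1) h ^+ k) * (1 - h) = 1 - h ^+ n.+1.
  by rewrite mulrC -opprB mulNr -subrX1 opprB.
by rewrite fps_coefD fps_coefN fps_coef_exp_lt // subr0.
Qed.

Fact fps_unitPl f g : g * f = 1 -> f \in fps_unit.
Proof.
move=> /(congr1 (fun h => fps_coef h 0)); rewrite fps_coef0M fps_coef1 => gf1.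
by rewrite inE; apply/unitrPr; exists (fps_coef g 0); rewrite mulrC.
Qed.

Fact fps_inv_out : {in [predC fps_unit], fps_inv =1 id}.
Proof. by move=> f /negPf Nf; rewrite /fps_inv Nf. Qed.

HB.instance Definition _ := GRing.ComNzRing_hasMulInverse.Build {fps R}
  fps_mulVf fps_unitPl fps_inv_out.

Lemma fps_unitE f : (f \is a GRing.unit) = (fps_coef f 0 \is a GRing.unit).
Proof. by []. Qed.

End FpsUnitRing.

(* {fps {fps R}} plays the role of R[[x, t]]: the outer series is in x, and   *)
(* its coefficients are series in t.  A series \sum_(k >= m) F k of elements  *)
(* of R[[x, t]] has sum S when, for all i and j, the coefficient of x^i t^j   *)
(* in its partial sums is eventually equal to that of S.                      *)
Definition fps2_coef (R : Type) (f : {fps {fps R}}) (i j : nat) : R :=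
  fps_coef (fps_coef f i) j.

Definition fps2_has_sum (R : comNzRingType) (m : nat)
    (F : nat -> {fps {fps R}}) (S : {fps {fps R}}) : Prop :=
  forall i j : nat, exists N : nat, forall n : nat, (N <= n)%N ->
    fps2_coef (\sum_(m <= k < n) F k) i j = fps2_coef S i j.

(* Permutations of [n] are elements of 'S_n, hence 0-based; a descent or peak *)
(* is recorded by the 'I_n-index of its position.                             *)
Section PermStatistics.
Variables (n : nat) (s : 'S_n).

Definition is_descent (i : 'I_n) : bool :=
  [exists j : 'I_n, (i.+1 == j) && (s j < s i)%N].

Definition is_peak (i : 'I_n) : bool :=
  [exists h : 'I_n, exists j : 'I_n,
    [&& h.+1 == i, i.+1 == j, (s h < s i)%N & (s j < s i)%N]].

Definition des : nat := #|[set i : 'I_n | is_descent i]|.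
Definition pk : nat := #|[set i : 'I_n | is_peak i]|.
Definition fix_num : nat := #|[set i : 'I_n | s i == i]|.
Definition is_derangement : bool := [forall i : 'I_n, s i != i].

End PermStatistics.

Definition P_pk_des_fix (R : comNzRingType) (n : nat) (y t z : R) : R :=
  \sum_(s : 'S_n) y ^+ (pk s).+1 * t ^+ (des s).+1 * z ^+ fix_num s.

Definition D_pk_des (R : comNzRingType) (n : nat) (y t : R) : R :=
  \sum_(s : 'S_n | is_derangement s) y ^+ (pk s).+1 * t ^+ (des s).+1.

(* The field Q(y, z) as the field of fractions of Q[y][z]; since y is         *)
(* invertible there, 1 / (y + t) is a power series in t over Q(y, z).         *)
Definition Qyz : fieldType := {fraction {poly {poly rat}}}.

Notation Qyz_xt := {fps {fps Qyz}}.

Definition fps2C (c : Qyz) : Qyz_xt := fpsC (fpsC c).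

Definition var_y : Qyz_xt := fps2C (tofrac ('X%:P : {poly {poly rat}})).
Definition var_z : Qyz_xt := fps2C (tofrac ('X : {poly {poly rat}})).
Definition var_t : Qyz_xt := fpsC (fpsX Qyz).
Definition var_x : Qyz_xt := fpsX {fps Qyz}.

(* Main.v *)
Require Import Defs.
From HB Require Import structures.
From mathcomp Require Import all_boot all_order all_algebra perm.
From mathcomp Require Import zify ring.

Set Implicit Arguments.
Unset Strict Implicit.
Unset Printing Implicit Defensive.

Import GRing.Theory.

(** Write the letters as 0, 1, ..., 2k-1, where the even letters are primed and
weigh y and the odd letters weigh 1.  Both sides are generating functions, in t
for k and in x for n, of the words of length n over these letters, counted by
weight and by fixed positions.

Order the positions of a word w by their letters, breaking ties from left to
right inside an odd letter and from right to left inside an even one.  The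
permutation s that lists the positions in this order is the only one for which
f = w o s is compatible with s: f is weakly increasing, a repeated odd letter
forbids a descent of s and a repeated even letter forces one.  A fixed point of
s is a position of w whose rank is itself ([sum_compatible_sum]).  Thus the sum
over words is a sum over permutations s of z ^ fix(s) times the weighted number
of sequences compatible with s.

For a fixed s this number is computed by adding one entry of f at a time while
remembering the parity of its last letter.  In terms of the series in t, each
ascent and each descent multiplies by a fixed rational function, which for a
descent depends on whether it ends a peak ([total_seriesS]); the product is the
summand of s on the left-hand side ([total_series_closed]).

On the other side, fixed positions carrying a given letter a can be inserted and
erased without disturbing the other fixed positions ([fixed_count_insert]): a
position p has rank p, so removing it lowers positions and ranks above p
together.  For odd a, such an insertion is always possible, and for even a it is
possible exactly when the word has no fixed a yet ([insert_fixedK],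
[erase_fixedK]).  Hence replacing 1 by z as the weight of a fixed a multiplies
the series in x by (1 - x) / (1 - z x) when a is odd and by
(1 + z x y) / (1 + x y) when a is even ([word_series_step]).  Starting from all
words, whose series is 1 / (1 - k (1 + y) x), one reaches the right-hand side
after treating all 2k letters ([word_series]).

Setting z = 0 keeps only the derangements, so (b) is a specialization of (a). *)

(** * Formal power series *)

Section PowerSeries.
Variable R : comNzRingType.
Local Open Scope ring_scope.
Local Notation X := (fpsX R).

Lemma coefXM (f : {fps R}) n :
  fps_coef (X * f) n = if n is n1.+1 then fps_coef f n1 else 0.
Proof.
case: n => [|n]; first by rewrite fps_coef0M mul0r.
rewrite fps_coefM big_ord_recl big_ord_recl /= mul0r add0r mul1r subn1.
by rewrite big1 ?addr0 // => i _; rewrite /= mul0r.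
Qed.

Lemma coefCM c (f : {fps R}) n : fps_coef (fpsC c * f) n = c * fps_coef f n.
Proof.
rewrite fps_coefM big_ord_recl /= subn0 big1 ?addr0 // => i _.
by rewrite /= mul0r.
Qed.

Fact fpsC_is_zmod_morphism : zmod_morphism (@fpsC R).
Proof.
by move=> a b; apply: fpsP => n; rewrite fps_coefD fps_coefN /=; case: eqP; rewrite ?subr0.
Qed.

Fact fpsC_is_monoid_morphism : monoid_morphism (@fpsC R).
Proof.
split=> [//|a b]; apply: fpsP => n; rewrite coefCM /=.
by case: eqP; rewrite ?mulr0.
Qed.

HB.instance Definition _ :=
  GRing.isZmodMorphism.Build R {fps R} (@fpsC R) fpsC_is_zmod_morphism.
HB.instance Definition _ :=
  GRing.isMonoidMorphism.Build R {fps R} (@fpsC R) fpsC_is_monoid_morphism.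

Lemma coefMXn (f : {fps R}) k n :
  fps_coef (f * fpsX R ^+ k) n = if (n < k)%N then 0 else fps_coef f (n - k).
Proof.
elim: k n => [|k IHk] n; first by rewrite mulr1 subn0.
by rewrite exprS mulrCA coefXM; case: n => [//|n]; rewrite IHk ltnS subSS.
Qed.

End PowerSeries.

Lemma eq_fps2_has_sum (R : comNzRingType) m (F G : nat -> {fps {fps R}}) S :
  F =1 G -> fps2_has_sum m F S -> fps2_has_sum m G S.
Proof.
move=> eqFG sumF i j; have [N sumN] := sumF i j; exists N => n /sumN <-.
by congr fps2_coef; apply: eq_bigr.
Qed.

(** Solves a product identity for [w] while keeping the three inverses apart, in
the order in which they appear on the right-hand side of the theorem. *)
Lemma solve_unit_factors (S : comUnitRingType) (u a b m n w c : S) :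
    (u \is a GRing.unit -> a \is a GRing.unit -> b \is a GRing.unit ->
  u * (a * b * w) = m * n -> n / a * (m / b) * (c / u) = w * c)%R.
Proof.
move=> unit_u unit_a unit_b eq_mn.
transitivity (m * n * (u^-1 * a^-1 * b^-1 * c))%R; first by ring.
rewrite -eq_mn.
transitivity ((u * u^-1) * (a * a^-1) * (b * b^-1) * w * c)%R; first by ring.
by rewrite !divrr // !mul1r.
Qed.

(** * Words, ranks and fixed positions *)

Section Words.
Variable m : nat.
Local Notation letter := 'I_m.
Local Notation word n := {ffun 'I_n -> letter}.

(** The order of the positions that standardization sorts: equal odd letters are
read from left to right and equal even ones from right to left. *)
Definition before n (w : word n) (p q : 'I_n) : bool :=
  (w p < w q) || (w p == w q) && (if odd (w p) then p < q else q < p).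

Definition rank n (w : word n) (p : 'I_n) : nat := \sum_q before w q p.

Definition fixed_count n (Q : pred letter) (w : word n) : nat :=
  \sum_p ((rank w p == p) && Q (w p)).

Definition insert n (p : 'I_n.+1) (a : letter) (w : word n) : word n.+1 :=
  [ffun i => if unlift p i is Some j then w j else a].

Definition erase n (p : 'I_n.+1) (v : word n.+1) : word n :=
  [ffun j => v (lift p j)].

(** The rank that a letter [a] receives when it is inserted at position [p]
([rank_insert_at]); so [a] can be inserted as a fixed letter exactly at the
fixed points of [slot w a]. *)
Definition slot n (w : word n) (a : letter) (p : nat) : nat :=
  \sum_j ((w j < a) || (w j == a) && (if odd a then j < p else p <= j)).

Lemma insert_at n p a (w : word n) : insert p a w p = a.
Proof. by rewrite ffunE unlift_none. Qed.

Lemma insert_lift n p a (w : word n) j : insert p a w (lift p j) = w j.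
Proof. by rewrite ffunE liftK. Qed.

Lemma eraseK n p a (w : word n) : erase p (insert p a w) = w.
Proof. by apply/ffunP => j; rewrite ffunE insert_lift. Qed.

Lemma insertK n p (v : word n.+1) : insert p (v p) (erase p v) = v.
Proof.
apply/ffunP => i; rewrite ffunE.
by case: unliftP => [j ->|->] //; rewrite ffunE.
Qed.

Lemma before_irr n (w : word n) p : before w p p = false.
Proof. by rewrite /before eqxx; case: ifP; lia. Qed.

Lemma before_trans n (w : word n) : transitive (before w).
Proof.
move=> q p r; rewrite /before.
case/orP=> [lt_pq|/andP[/eqP -> tie_pq]];
  case/orP=> [lt_qr|/andP[/eqP <- tie_qr]].
- by rewrite (ltn_trans lt_pq).
- by rewrite lt_pq.
- by rewrite lt_qr.
by rewrite eqxx ltnn /=; move: tie_pq tie_qr; case: ifP; lia.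
Qed.

Lemma before_total n (w : word n) p q :
  p != q -> before w p q || before w q p.
Proof.
rewrite -val_eqE /before -!val_eqE /= => neq_pq.
case: (ltngtP (w p) (w q)) => //= /val_inj ->.
by case: ifP; lia.
Qed.

Lemma rank_lt n (w : word n) p q : before w p q -> rank w p < rank w q.
Proof.
move=> lt_pq; rewrite /rank [ltnLHS](bigD1 p) //= [ltnRHS](bigD1 p) //= lt_pq.
rewrite before_irr add0n add1n ltnS; apply: leq_sum => r _.
by case lt_rp: (before w r p); rewrite // (before_trans lt_rp lt_pq).
Qed.

Lemma before_rank n (w : word n) p q : before w p q = (rank w p < rank w q).
Proof.
case lt_pq: (before w p q); first by rewrite rank_lt.
have [->|/(before_total w)] := eqVneq p q; first by rewrite ltnn.
by rewrite lt_pq /= => /rank_lt; case: ltngtP.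
Qed.

Lemma rank_inj n (w : word n) : injective (rank w).
Proof.
move=> p q eq_r; apply/eqP/negPn/negP => /(before_total w).
by rewrite !before_rank eq_r ltnn.
Qed.

Lemma rank_bound n (w : word n) p : rank w p < n.
Proof.
rewrite /rank (bigD1 p) //= before_irr add0n.
apply: (@leq_ltn_trans (\sum_(q < n | q != p) 1)).
  by apply: leq_sum => q _; case: before.
rewrite sum1_card (cardC1 p) card_ord.
by case: n p w => [[]|].
Qed.

Lemma ltn_lift n (p : 'I_n.+1) (i j : 'I_n) : (lift p i < lift p j) = (i < j).
Proof. by rewrite !ltnNge /= leq_bump2. Qed.

Lemma before_insert n p a (w : word n) i j :
  before (insert p a w) (lift p i) (lift p j) = before w i j.
Proof. by rewrite /before !insert_lift !ltn_lift. Qed.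

Lemma rank_insert_lift n p a (w : word n) j :
  rank (insert p a w) (lift p j) =
  before (insert p a w) p (lift p j) + rank w j.
Proof.
rewrite /rank (bigD1_ord p) //=; congr (_ + _).
by apply: eq_bigr => i _; rewrite before_insert.
Qed.

Lemma rank_insert_at n (p : 'I_n.+1) a (w : word n) :
  rank (insert p a w) p = slot w a p.
Proof.
rewrite /rank (bigD1_ord p) //= before_irr add0n.
apply: eq_bigr => j _; rewrite /before insert_lift insert_at.
have [->|//] := eqVneq (w j) a; rewrite ltnn /=.
by congr (nat_of_bool (if _ then _ else _)); rewrite /= /bump; lia.
Qed.

(** With position [p] of rank [p], inserting it shifts by one exactly the
positions and the ranks that are at least [p]; hence the other fixed positions
are preserved and none is created. *)
Lemma fixed_count_insert n p a (w : word n) Q :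
  rank (insert p a w) p = p ->
  fixed_count Q (insert p a w) = Q a + fixed_count Q w.
Proof.
move=> fix_p; rewrite /fixed_count (bigD1_ord p) //= fix_p eqxx insert_at.
congr (_ + _); apply: eq_bigr => j _; rewrite insert_lift; congr (_ && _ : nat).
have neq_r: rank (insert p a w) (lift p j) <> rank (insert p a w) p.
  by move/rank_inj/eqP; rewrite eq_sym (negPf (neq_lift p j)).
move: neq_r (rank_insert_lift p a w j); rewrite before_rank fix_p /= /bump.
by move=> *; apply/eqP/eqP; lia.
Qed.

(** As [p] grows by one, [slot w a p - p] moves by 0 or -1 for odd [a] and by -1
or -2 for even [a].  In the odd case it cannot jump over 0; in the even case it
does so exactly at a fixed [a]. *)
Lemma slotS n (w : word n) (a : letter) (p : 'I_n) :
  if odd a then slot w a p.+1 = slot w a p + (w p == a)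
  else slot w a p = slot w a p.+1 + (w p == a).
Proof.
have sum_p : \sum_(j < n) ((j == p) && (w p == a)) = (w p == a).
  by rewrite (bigD1 p) //= eqxx big1 ?addn0 // => j /negPf ->.
case: ifP => oa; rewrite -[X in _ = _ + X]sum_p -big_split;
  apply: eq_bigr => j _; rewrite oa /=;
  have [->|] := eqVneq j p; rewrite -?val_eqE /=; case: (ltngtP (w _) a) => //=;
  lia.
Qed.

Lemma slot_le n (w : word n) a p : slot w a p <= n.
Proof.
rewrite -[leqRHS]card_ord -sum1_card; apply: leq_sum => j _; exact: leq_b1.
Qed.

Lemma slot_odd_mono n (w : word n) (a : letter) p q : odd a -> p <= q ->
  slot w a p <= slot w a q <= slot w a p + (q - p).
Proof.
move=> oa le_pq; apply/andP; split.
  apply: leq_sum => j _; rewrite oa; case: (w j < a) => //=.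
  by case: (w j == a) => //=; lia.
elim: q le_pq => [|q IHq]; first by rewrite leqn0 => /eqP ->; rewrite addn0.
rewrite leq_eqVlt => /orP[/eqP ->|]; first by rewrite subnn addn0.
rewrite ltnS => le_pq; rewrite subSn // addnS -[leqRHS]addn1.
have [lt_qn|le_nq] := ltnP q n.
  have := slotS w a (Ordinal lt_qn); rewrite oa /= => ->.
  by rewrite leq_add ?leq_b1 ?IHq.
apply: leq_trans (leq_trans (IHq le_pq) (leq_addr _ _)).
apply: leq_sum => j _; have := ltn_ord j; rewrite oa.
by case: (w j < a) => //=; case: (w j == a) => //=; lia.
Qed.

Lemma slot_even_anti n (w : word n) (a : letter) p q : ~~ odd a -> p <= q ->
  slot w a q <= slot w a p.
Proof.
move=> /negPf oa le_pq; apply: leq_sum => j _; rewrite oa.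
by case: (w j < a) => //=; case: (w j == a) => //=; lia.
Qed.

(** * Inserting and erasing a fixed letter *)

Definition is_fixed n (v : word n) (a : letter) (p : 'I_n) : bool :=
  (rank v p == p) && (v p == a).

(** The bound [slot w a p <= p] always holds at [p = n], and at the least such [p]
it is an equality whenever an insertion is possible ([insertion_pointP]). *)
Definition insertion_point n (w : word n) (a : letter) : 'I_n.+1 :=
  [arg min_(p < ord_max | slot w a p <= p) p].

(** The leftmost fixed position of letter [a], if there is one.  Choosing the
least position here and in [insertion_point] makes the two operations inverse
to each other. *)
Definition erasure_point n (v : word n.+1) (a : letter) : 'I_n.+1 :=
  [arg min_(p < odflt ord0 [pick p | is_fixed v a p] | is_fixed v a p) p].

Lemma fixed_count_gt0 n (v : word n) a :
  (0 < fixed_count (pred1 a) v) = [exists p, is_fixed v a p].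
Proof.
rewrite lt0n sum_nat_eq0 negb_forall.
by apply: eq_existsb => p; rewrite eqb0 negbK.
Qed.

Lemma rank_slot n (w : word n) p :
  rank w p = slot w (w p) (if odd (w p) then p : nat else p.+1).
Proof.
apply: eq_bigr => q _; rewrite /before.
by have [->|//] := eqVneq (w q) (w p); rewrite ltnn /=; case: ifP.
Qed.

(** At the position before the least [p], [slot] is still too large; since [slot]
decreases there only on an even letter [a], overshooting would make that letter
a fixed one. *)
Lemma insertion_pointP n (w : word n) (a : letter) (p := insertion_point w a) :
    odd a || (fixed_count (pred1 a) w == 0) ->
  slot w a p = p /\ (forall q : 'I_n.+1, slot w a q <= q -> p <= q).
Proof.
move=> insertable; rewrite {}/p /insertion_point; case: arg_minnP => [|p].
  exact: slot_le.
move=> le_p min_p; split=> //; apply/eqP; rewrite eqn_leq le_p /=.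
case def_p: (nat_of_ord p) => [|p1] //.
have lt_p1n : p1 < n by rewrite -ltnS -def_p ltn_ord.
pose j := Ordinal lt_p1n.
have gt_p1 : p1 < slot w a p1.
  rewrite ltnNge; apply/negP => /(min_p (widen_ord (leqnSn n) j)).
  by rewrite [leqLHS]def_p ltnn.
have := slotS w a j; case: ifP insertable => oa /=.
  by move=> _; rewrite -def_p; lia.
rewrite sum_nat_eq0 => /forallP/(_ j); rewrite rank_slot /= -[p1.+1]def_p.
have [->|_] := eqVneq (w j) a; last by lia.
rewrite oa /= andbT eqb0 => /eqP.
lia.
Qed.

Lemma erasure_pointP n (v : word n.+1) (a : letter) (p := erasure_point v a) :
    0 < fixed_count (pred1 a) v ->
  is_fixed v a p /\ (forall q, is_fixed v a q -> p <= q).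
Proof.
rewrite fixed_count_gt0 => /existsP[q fix_q].
rewrite {}/p /erasure_point; case: arg_minnP => //.
by case: pickP => [p //|/(_ q)]; rewrite fix_q.
Qed.

Definition insert_fixed n (a : letter) (w : word n) : word n.+1 :=
  insert (insertion_point w a) a w.

Definition erase_fixed n (a : letter) (v : word n.+1) : word n :=
  erase (erasure_point v a) v.

Section Insertable.
Variables (n : nat) (a : letter) (w : word n).
Hypothesis insertable : odd a || (fixed_count (pred1 a) w == 0).

Lemma fixed_count_insert_fixed Q :
  fixed_count Q (insert_fixed a w) = Q a + fixed_count Q w.
Proof.
apply: fixed_count_insert; rewrite rank_insert_at.
by case: (insertion_pointP insertable).
Qed.

(** A fixed [a] to the left of the inserted one would, for odd [a], be an earlier
point of insertion; for even [a] two fixed positions are impossible, because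
their ranks would be in reverse order. *)
Lemma insert_fixedK : erase_fixed a (insert_fixed a w) = w.
Proof.
have [slot_p min_p] := insertion_pointP insertable.
rewrite /erase_fixed; set v := insert_fixed a w; set p := insertion_point w a.
rewrite -/p in slot_p min_p.
have rank_p: rank v p = p by rewrite rank_insert_at.
have vp: v p = a by rewrite /v /insert_fixed insert_at.
have v_gt0 : 0 < fixed_count (pred1 a) v.
  by rewrite fixed_count_insert_fixed /= eqxx.
have [/andP[/eqP rank_q /eqP vq] min_q] := erasure_pointP v_gt0.
set q := erasure_point v a in rank_q vq min_q *.
suff -> : q = p by rewrite /v /insert_fixed eraseK.
have := min_q p; rewrite /is_fixed rank_p vp !eqxx /= => /(_ isT) le_qp.
apply/val_inj/eqP; rewrite eqn_leq le_qp leqNgt; apply/negP => lt_qp.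
have := before_rank v p q; rewrite rank_p rank_q /before vp vq ltnn eqxx /=.
case: ifP => oa; last by rewrite lt_qp; lia.
move=> _; have : slot w a q <= q.
  rewrite -{2}rank_q.
  have [//|j def_q _] := @unlift_some _ p q; first by rewrite -val_eqE gtn_eqF.
  have q_j : q = j :> nat.
    by have : q = bump p j :> nat; [rewrite def_q | rewrite /bump; lia].
  have wj : w j = a by rewrite -vq def_q /v /insert_fixed insert_lift.
  by rewrite def_q rank_insert_lift -def_q rank_slot wj oa q_j leq_addl.
by move/min_p; rewrite leqNgt lt_qp.
Qed.

End Insertable.

(** After erasing the leftmost fixed [a] at [q], a point of insertion [p < q] is
impossible.  For odd [a], [slot] would grow by one at each step from [p] to [q],
so the letter at [p] would be [a], and fixed; for even [a], [slot] does not
increase. *)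
Lemma erase_fixedK n (a : letter) (v : word n.+1) :
    0 < fixed_count (pred1 a) v ->
  (odd a || (fixed_count (pred1 a) (erase_fixed a v) == 0)) /\
  insert_fixed a (erase_fixed a v) = v.
Proof.
move=> v_gt0; have [/andP[/eqP rank_q /eqP vq] min_q] := erasure_pointP v_gt0.
set w := erase_fixed a v; set q := erasure_point v a.
rewrite -/q in rank_q vq min_q.
have def_v : v = insert q a w by rewrite -vq insertK.
have slot_q : slot w a q = q by rewrite -rank_insert_at -def_v.
have insertable : odd a || (fixed_count (pred1 a) w == 0).
  apply: contraT; rewrite negb_or => /andP[oa].
  have := @fixed_count_insert _ q a w (pred1 a).
  rewrite -def_v => /(_ rank_q) /=; rewrite eqxx => fc_v.
  rewrite -lt0n fixed_count_gt0 => /existsP[j /andP[/eqP rank_j /eqP wj]].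
  have := rank_insert_lift q a w j; rewrite rank_j -def_v.
  rewrite before_rank rank_q.
  have vj : v (lift q j) = a by rewrite def_v insert_lift.
  have := before_rank v q (lift q j); have := before_rank v (lift q j) q.
  rewrite /before vq vj ltnn eqxx (negPf oa) rank_q /=.
  by rewrite /bump; lia.
split=> //; rewrite [RHS]def_v /insert_fixed.
have [slot_p min_p] := insertion_pointP insertable.
set p := insertion_point w a in slot_p min_p *.
suff -> : p = q by [].
have le_pq : p <= q by rewrite min_p ?slot_q.
apply/val_inj/eqP; rewrite eqn_leq le_pq leqNgt; apply/negP => lt_pq.
case oa: (odd a); last first.
  by have := slot_even_anti w (negbT oa) le_pq; rewrite slot_p slot_q leqNgt lt_pq.
have lt_pn : p < n by rewrite (leq_trans lt_pq) // -ltnS ltn_ord.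
pose j := Ordinal lt_pn.
have wj : w j = a.
  have := slotS w a j; rewrite oa; case: eqVneq => //= _.
  have /andP[_] := slot_odd_mono w oa lt_pq.
  rewrite slot_q addn0 slot_p => + slot_p1; rewrite slot_p1.
  by move: lt_pq => /=; lia.
have def_p : p = lift q j.
  by apply: val_inj; rewrite /= /bump; move: lt_pq => /=; lia.
have vp : v p = a by rewrite def_p def_v insert_lift.
have rank_p : rank v p = p.
  rewrite def_p [in LHS]def_v rank_insert_lift -def_v -def_p.
  rewrite rank_slot wj oa /= slot_p /before vq vp ltnn eqxx oa.
  by move: lt_pq => /=; lia.
have /min_q : is_fixed v a p by rewrite /is_fixed rank_p vp !eqxx.
by rewrite leqNgt lt_pq.
Qed.

End Words.

(** * Counting words by fixed positions *)

Section FixedLetterSums.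
Variables (m : nat) (R : comNzRingType) (y z : R).
Local Notation letter := 'I_m.
Local Notation word n := {ffun 'I_n -> letter}.
Local Open Scope ring_scope.

Definition letter_weight (c : nat) : R := if odd c then 1 else y.

Definition weight n (w : word n) : R := \prod_i letter_weight (w i).

Definition word_sum (c n : nat) : R :=
  \sum_(w : word n) weight w * z ^+ fixed_count (fun b => (b < c)%N) w.

Lemma weight_insert n p a (w : word n) :
  weight (insert p a w) = letter_weight a * weight w.
Proof.
rewrite /weight (bigD1_ord p) //= insert_at; congr (_ * _).
by apply: eq_bigr => j _; rewrite insert_lift.
Qed.

(** Every word with a fixed [a] arises exactly once by an insertion, from any
word if [a] is odd and from a word without fixed [a] if [a] is even. *)
Lemma sum_fixed_letter n (a : letter) (F : word n.+1 -> R) :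
  \sum_(v : word n.+1 | (0 < fixed_count (pred1 a) v)%N) F v =
  \sum_(w : word n | odd a || (fixed_count (pred1 a) w == 0%N))
     F (insert_fixed a w).
Proof.
rewrite (reindex_onto (insert_fixed a) (@erase_fixed m n a)) => [|v v_gt0].
  apply: eq_bigl => w; apply/andP/idP => [[gt0 /eqP defw]|ins_w].
    by have [] := erase_fixedK gt0; rewrite defw.
  by rewrite insert_fixedK // fixed_count_insert_fixed //= eqxx.
by have [] := erase_fixedK v_gt0.
Qed.

(** Interpolates between two consecutive values of [word_sum]: the fixed letters
below [a] count for [z] and the fixed letters [a] for [u]. *)
Definition marked_sum (a : letter) (u : R) (n : nat) : R :=
  \sum_(w : word n) weight w * z ^+ fixed_count (fun b => (b < a)%N) w
     * u ^+ fixed_count (pred1 a) w.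

Definition avoiding_sum (a : letter) (n : nat) : R :=
  \sum_(w : word n | fixed_count (pred1 a) w == 0%N)
     weight w * z ^+ fixed_count (fun b => (b < a)%N) w.

Lemma marked_sum1 a n : marked_sum a 1 n = word_sum a n.
Proof. by apply: eq_bigr => w _; rewrite expr1n mulr1. Qed.

Lemma marked_sumz (a : letter) n : marked_sum a z n = word_sum a.+1 n.
Proof.
apply: eq_bigr => w _; rewrite -mulrA -exprD -big_split /=.
congr (_ * _ ^+ _); apply: eq_bigr => p _; rewrite ltnS -val_eqE /=.
by case: (rank w p == p); case: (ltngtP (w p) a).
Qed.

Lemma marked_sumS a u n :
  marked_sum a u n.+1 = avoiding_sum a n.+1
    + u * letter_weight a * (if odd a then marked_sum a u n
                             else avoiding_sum a n).
Proof.
rewrite /marked_sum.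
rewrite (bigID (fun w : word _ => fixed_count (pred1 a) w == 0%N)) /=.
congr (_ + _); first by apply: eq_bigr => w /eqP ->; rewrite mulr1.
under eq_bigl do rewrite -lt0n; rewrite sum_fixed_letter.
transitivity (u * letter_weight a *
  \sum_(w : word n | odd a || (fixed_count (pred1 a) w == 0%N))
   (weight w * z ^+ fixed_count (fun b => (b < a)%N) w
     * u ^+ fixed_count (pred1 a) w)).
  rewrite mulr_sumr; apply: eq_bigr => w ins_w.
  rewrite !fixed_count_insert_fixed //= eqxx ltnn weight_insert add0n add1n exprS.
  by ring.
congr (_ * _); case: ifP => oa /=; first exact: eq_bigl.
by apply: eq_bigr => w /eqP ->; rewrite mulr1.
Qed.

Lemma fixed_count_word0 Q (w : word 0) : fixed_count Q w = 0%N.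
Proof. by rewrite /fixed_count big_ord0. Qed.

Lemma weight_word0 (w : word 0) : weight w = 1.
Proof. by rewrite /weight big_ord0. Qed.

Lemma card_word0 : #|{: word 0}| = 1%N.
Proof. by rewrite card_ffun [#|'I_0|]card_ord expn0. Qed.

Lemma word_sum_n0 c : word_sum c 0 = 1.
Proof.
rewrite /word_sum (eq_bigr (fun=> 1)) => [|w _].
  by rewrite sumr_const card_word0.
by rewrite fixed_count_word0 weight_word0 mulr1.
Qed.

Lemma avoiding_sum_n0 a : avoiding_sum a 0 = 1.
Proof.
rewrite -(word_sum_n0 a); apply: eq_bigl => w.
by rewrite fixed_count_word0.
Qed.

Lemma marked_sum_n0 a u : marked_sum a u 0 = 1.
Proof.
rewrite -(word_sum_n0 a); apply: eq_bigr => w _.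
by rewrite !fixed_count_word0 mulr1.
Qed.

Lemma word_sum0 n : word_sum 0 n = (\sum_(c < m) letter_weight c) ^+ n.
Proof.
rewrite -{2}[n]card_ord -prodr_const.
rewrite (bigA_distr_bigA (fun _ (c : letter) => letter_weight c)).
apply: eq_bigr => w _; rewrite [fixed_count _ _]big1 ?mulr1 // => p _.
by rewrite andbF.
Qed.

Local Notation X := (fpsX R).

(** Fixed letters [a] can be added freely if [a] is odd, whence a geometric
series in [u X], and at most once if [a] is even. *)
Lemma marked_series (a : letter) u :
  let T := Fps (marked_sum a u) in let A := Fps (avoiding_sum a) in
  if odd a then (1 - fpsC u * X) * T = A else T = (1 + fpsC (u * y) * X) * A.
Proof.
have := marked_sumS a u; rewrite /letter_weight; case: ifP => _ recT /=.
  apply: fpsP => n; rewrite mulrBl mul1r fps_coefD fps_coefN -mulrA coefCM coefXM.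
  case: n => [|n] /=; first by rewrite mulr0 subr0 marked_sum_n0 avoiding_sum_n0.
  by rewrite recT mulr1 addrK.
apply: fpsP => n; rewrite mulrDl mul1r fps_coefD -mulrA coefCM coefXM.
case: n => [|n] /=; first by rewrite mulr0 addr0 marked_sum_n0 avoiding_sum_n0.
by rewrite recT.
Qed.

(** The series without fixed [a] is common to [u = 1] and [u = z], so it can be
eliminated. *)
Lemma word_series_step (a : letter) :
  let W c := Fps (word_sum c) in
  if odd a then (1 - fpsC z * X) * W a.+1 = (1 - X) * W a
  else (1 + fpsC y * X) * W a.+1 = (1 + fpsC (z * y) * X) * W a.
Proof.
move=> W.
have -> : W a.+1 = Fps (marked_sum a z) by apply: fpsP => n; rewrite /= marked_sumz.
have -> : W a = Fps (marked_sum a 1) by apply: fpsP => n; rewrite /= marked_sum1.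
have := marked_series a z; have := marked_series a 1; case: ifP => _ /= e1 ez.
  by rewrite ez -e1; congr ((1 - _) * _); apply: fpsP => n; rewrite coefCM mul1r.
by rewrite ez e1 mul1r; ring.
Qed.

End FixedLetterSums.

Section WordSeries.
Variables (R : comNzRingType) (y z : R) (k : nat).
Local Open Scope ring_scope.
Local Notation X := (fpsX R).
Local Notation W c := (Fps (word_sum k.*2 y z c)).

Lemma sum_letter_weight : \sum_(c < k.*2) letter_weight y c = k%:R * (1 + y).
Proof.
elim: (k) => [|k' IHk]; first by rewrite big_ord0 mul0r.
rewrite doubleS !big_ord_recr /= IHk /letter_weight /= odd_double /=.
by rewrite -addn1 natrD; ring.
Qed.

Lemma word_series0 : (1 - fpsC (k%:R * (1 + y)) * X) * W 0 = 1.
Proof.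
apply: fpsP => n; rewrite mulrBl mul1r fps_coefD fps_coefN -mulrA coefCM coefXM.
case: n => [|n] /=; rewrite !word_sum0 sum_letter_weight ?mulr0 ?subr0 ?expr0 //.
by rewrite exprS subrr.
Qed.

Lemma word_series_double c : (c <= k)%N ->
  ((1 - fpsC z * X) * (1 + fpsC y * X)) ^+ c * W c.*2 =
  ((1 - X) * (1 + fpsC (z * y) * X)) ^+ c * W 0.
Proof.
elim: c => [|c IHc] lt_ck; first by rewrite !expr0 !mul1r.
have lt0 : (c.*2 < k.*2)%N by rewrite ltn_double.
have lt1 : (c.*2.+1 < k.*2)%N by rewrite ltn_Sdouble.
have := word_series_step y z (Ordinal lt0); have := word_series_step y z (Ordinal lt1).
rewrite /= odd_double /= => step1 step0.
move: step1 step0 (IHc (ltnW lt_ck)); rewrite doubleS !exprSr.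
set A := 1 - fpsC z * X; set B := 1 + fpsC y * X.
set C := 1 - X; set D := 1 + fpsC (z * y) * X.
set w0 := W c.*2; set w1 := W c.*2.+1; set w2 := W c.*2.+2 => step1 step0 {}IHc.
transitivity ((A * B) ^+ c * (B * (A * w2))); first by ring.
rewrite step1; transitivity ((A * B) ^+ c * (C * (B * w1))); first by ring.
rewrite step0; transitivity (C * D * ((A * B) ^+ c * w0)); first by ring.
by rewrite IHc; ring.
Qed.

Lemma word_series :
  (1 - fpsC (k%:R * (1 + y)) * X)
   * ((1 - fpsC z * X) ^+ k * (1 + fpsC y * X) ^+ k * W k.*2) =
  (1 - X) ^+ k * (1 + fpsC (z * y) * X) ^+ k.
Proof.
by rewrite -!exprMn word_series_double // mulrCA word_series0 mulr1.
Qed.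

End WordSeries.

(** * Standardization *)

Section Standardization.
Variables (m n : nat).
Local Notation word := {ffun 'I_n -> 'I_m}.

(** [tie d a b]: the letter [b] may follow [a] in a compatible sequence, where [d]
tells whether the permutation descends at this place. *)
Definition tie (d : bool) (a b : nat) : bool :=
  (a < b) || (a == b) && (if odd a then ~~ d else d).

Definition compatible (s : 'S_n) (f : word) : bool :=
  [forall i : 'I_n, forall j : 'I_n, (i.+1 == j) ==> tie (s j < s i) (f i) (f j)].

Definition rank_ord (w : word) (p : 'I_n) : 'I_n := Ordinal (rank_bound w p).

Lemma rank_ord_inj w : injective (rank_ord w).
Proof. by move=> p q [/rank_inj]. Qed.

Definition sorting_perm (w : word) : 'S_n := (perm (@rank_ord_inj w))^-1%g.

Lemma rank_sorting w i : rank w (sorting_perm w i) = i.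
Proof. by have := permKV (perm (@rank_ord_inj w)) i; rewrite permE => /(congr1 val). Qed.

(** Compatibility of [w o s] says that [s] lists the positions in the order
[before w], which determines [s]: the rank of [s i] is then [i]. *)
Lemma compatible_sorting (s : 'S_n) (w : word) :
  compatible s [ffun i => w (s i)] = (s == sorting_perm w).
Proof.
have compatE : compatible s [ffun i => w (s i)] =
    [forall i : 'I_n, forall j : 'I_n, (i.+1 == j) ==> before w (s i) (s j)].
  apply: eq_forallb => i; apply: eq_forallb => j; rewrite !ffunE.
  have [ij|//] := eqVneq i.+1 j; rewrite /= /tie /before -val_eqE /=.
  have neq_s : s i != s j :> nat.
    by rewrite (inj_eq val_inj) (inj_eq perm_inj) -val_eqE /= -ij; lia.
  by congr (_ || _ && _); case: ifP => _ //; move: neq_s; lia.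
rewrite compatE; apply/idP/eqP => [incr|-> {compatE}]; last first.
  apply/forallP => i; apply/forallP => j; apply/implyP => /eqP ij.
  by rewrite before_rank !rank_sorting ij.
have incr_lt d (i j : 'I_n) : j = (i + d).+1 :> nat -> before w (s i) (s j).
  elim: d j => [|d IHd] j def_j.
    by move/forallP/(_ i)/forallP/(_ j)/implyP: incr; apply; rewrite def_j addn0.
  have lt_id : (i + d).+1 < n by rewrite -addnS (ltn_trans _ (ltn_ord j)) ?def_j.
  apply: before_trans (IHd (Ordinal lt_id) erefl) _.
  move/forallP/(_ (Ordinal lt_id))/forallP/(_ j)/implyP: incr; apply.
  by rewrite /= def_j addnS.
have before_s i j : before w (s i) (s j) = (i < j).
  have lt_before (i1 j1 : 'I_n) : i1 < j1 -> before w (s i1) (s j1).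
    by move=> lt_ij; apply: (incr_lt (j1 - i1).-1); lia.
  have [/lt_before //|/lt_before|/val_inj ->] := ltngtP i j.
    by rewrite !before_rank; case: ltngtP.
  exact: before_irr.
have rank_s i : rank w (s i) = i.
  rewrite /rank (reindex_inj (@perm_inj _ s)) /=.
  under eq_bigr do rewrite before_s.
  rewrite -[RHS]card_ord -sum1_card (big_ord_widen n (fun=> 1)) 1?ltnW //.
  by rewrite [RHS]big_mkcond; apply: eq_bigr => j _; case: ltnP.
apply/permP => i; apply: (@rank_inj _ _ w).
by rewrite rank_s rank_sorting.
Qed.

Lemma fix_num_sorting (w : word) :
  fix_num (sorting_perm w) = fixed_count predT w.
Proof.
rewrite /fix_num /fixed_count -sum1_card big_mkcond.
apply: eq_bigr => i _; rewrite inE andbT; congr nat_of_bool.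
apply/eqP/eqP => [/val_inj fix_i|fix_i].
  by rewrite -{1}fix_i rank_sorting.
by congr val; apply: (@rank_inj _ _ w); rewrite rank_sorting.
Qed.

Local Open Scope ring_scope.
Variables (R : comNzRingType) (y z : R).

Definition compatible_sum (s : 'S_n) : R :=
  \sum_(f : word | compatible s f) weight y f.

(** Exchanges the sums over permutations and over words; the word [w] is paired
with its sorting permutation only. *)
Lemma sum_compatible_sum :
  \sum_(s : 'S_n) compatible_sum s * z ^+ fix_num s = word_sum m y z m n.
Proof.
have -> : word_sum m y z m n =
    \sum_(w : word) \sum_(s | s == sorting_perm w) weight y w * z ^+ fix_num s.
  apply: eq_bigr => w _; rewrite big_pred1_eq fix_num_sorting.
  congr (_ * _ ^+ _); apply: eq_bigr => p _.
  by rewrite ltn_ord.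
rewrite (exchange_big_dep xpredT) //=; apply: eq_bigr => s _.
rewrite /compatible_sum mulr_suml.
rewrite (reindex (fun w : word => [ffun i => w (s i)])) /=; last first.
  exists (fun w : word => [ffun i => w (s^-1%g i)]) => w _; apply/ffunP => i.
    by rewrite !ffunE permKV.
  by rewrite !ffunE permK.
apply: eq_big => [w|w _]; first by rewrite compatible_sorting.
congr (_ * _); rewrite /weight [RHS](reindex_inj (@perm_inj _ s)).
by apply: eq_bigr => i _; rewrite ffunE.
Qed.

End Standardization.

(** * Descents and peaks of a permutation as a boolean word *)

Section DescentWordOfPerm.
Variables (n : nat) (s : 'S_n.+1).

(** Indexing by naturals lets the transfer below recurse on the length; only the
values at [i < n] describe [s]. *)
Definition descent_word (i : nat) : bool := s (inord i.+1) < s (inord i).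

Definition peak_word (d : nat -> bool) (i : nat) : bool :=
  [&& 0 < i, ~~ d i.-1 & d i].

Lemma descent_wordE (i j : 'I_n.+1) : i.+1 = j -> (s j < s i) = descent_word i.
Proof. by move=> ij; rewrite /descent_word ij !inord_val. Qed.

Lemma des_descent_word : des s = \sum_(i < n) descent_word i.
Proof.
rewrite /des -sum1_card big_mkcond big_ord_recr /= inE.
have -> : is_descent s ord_max = false.
  by apply/existsP => -[j /andP[/eqP def_j _]]; have := ltn_ord j; rewrite -def_j ltnn.
rewrite addn0; apply: eq_bigr => i _; rewrite inE; congr nat_of_bool.
have succ_i : (widen_ord (leqnSn n) i).+1 = lift ord0 i by rewrite lift0.
apply/existsP/idP => [[j /andP[/eqP ij]]|desc_i]; first by rewrite (descent_wordE ij).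
by exists (lift ord0 i); rewrite succ_i eqxx (descent_wordE succ_i).
Qed.

Lemma pk_descent_word : pk s = \sum_(i < n) peak_word descent_word i.
Proof.
rewrite /pk -sum1_card big_mkcond big_ord_recr /= inE.
have -> : is_peak s ord_max = false.
  apply/existsP => -[h /existsP[j /and4P[_ /eqP def_j _ _]]].
  by have := ltn_ord j; rewrite -def_j ltnn.
rewrite addn0; apply: eq_bigr => i _; rewrite inE; congr nat_of_bool.
have succ_i : (widen_ord (leqnSn n) i).+1 = lift ord0 i by rewrite lift0.
rewrite /peak_word -(descent_wordE succ_i).
apply/existsP/and3P => [[h /existsP[j /and4P[/eqP hi /eqP ij lt_hi gt_ij]]]|].
  have -> : lift ord0 i = j by apply: val_inj; rewrite /= -ij.
  have def_h : h = i.-1 :> nat by have := congr1 predn hi.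
  split=> //; first by move: hi => /= <-.
  by rewrite -def_h -(descent_wordE hi) -leqNgt ltnW.
case=> i_gt0 asc_i desc_i.
have lt_i1 : i.-1 < n.+1 by have := ltn_ord i; lia.
have hi : (Ordinal lt_i1).+1 = widen_ord (leqnSn n) i by rewrite /= prednK.
exists (Ordinal lt_i1); apply/existsP; exists (lift ord0 i).
rewrite hi succ_i !eqxx desc_i andbT /=; move: asc_i.
rewrite -[i.-1]/(nat_of_ord (Ordinal lt_i1)) -(descent_wordE hi) -leqNgt leq_eqVlt.
case/orP=> // /eqP/val_inj/perm_inj /(congr1 val) /=; lia.
Qed.

End DescentWordOfPerm.

(** * Transfer along a descent word *)

Section Transfer.
Variables (R : comNzRingType) (y : R) (d : nat -> bool).
Local Open Scope ring_scope.

(** The weighted number of sequences of [n.+1] letters with last letter [c] that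
follow the descent word [d] ([sum_follows]). *)
Fixpoint last_letter_sum (n c : nat) : R :=
  if n is n1.+1 then
    letter_weight y c *
    \sum_(b < c.+1) (tie (d n1) b c)%:R * last_letter_sum n1 b
  else letter_weight y c.

Definition follows m n (f : {ffun 'I_n -> 'I_m}) : bool :=
  [forall i : 'I_n, forall j : 'I_n, (i.+1 == j) ==> tie (d i) (f i) (f j)].

Lemma sum_insert m n (p : 'I_n.+1) (F : {ffun 'I_n.+1 -> 'I_m} -> R) :
  \sum_v F v = \sum_a \sum_(w : {ffun 'I_n -> 'I_m}) F (insert p a w).
Proof.
rewrite pair_bigA /= (reindex (fun aw => insert p aw.1 aw.2)) //=.
exists (fun v : {ffun 'I_n.+1 -> 'I_m} => (v p, erase p v)) => [[a w] _|v _] /=.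
  by rewrite insert_at eraseK.
exact: insertK.
Qed.

Lemma follows_insert m n c (f : {ffun 'I_n.+1 -> 'I_m}) :
  follows (insert ord_max c f) = follows f && tie (d n) (f ord_max) c.
Proof.
apply/idP/andP => [fol|[fol tie_c]].
  split.
    apply/forallP => i; apply/forallP => j; apply/implyP => /eqP ij.
    move/forallP/(_ (lift ord_max i))/forallP/(_ (lift ord_max j)): fol.
    by rewrite !insert_lift !lift_max ij eqxx.
  move/forallP/(_ (lift ord_max ord_max))/forallP/(_ ord_max): fol.
  by rewrite insert_lift insert_at lift_max eqxx.
apply/forallP => i; apply/forallP => j; apply/implyP.
case: (unliftP ord_max i) => [i1|] ->; last first.
  by move=> /eqP /= def_j; have := ltn_ord j; rewrite -def_j ltnn.
case: (unliftP ord_max j) => [j1|] ->; rewrite lift_max insert_lift.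
  rewrite lift_max insert_lift; move/forallP/(_ i1)/forallP/(_ j1): fol.
  by move/implyP.
rewrite insert_at /= eqSS => /eqP i1n; rewrite i1n.
by have -> : i1 = ord_max by apply: val_inj.
Qed.

(** The test function [G] of the last letter carries the induction: appending a
letter weights the sequences by whether their last letter allows it. *)
Lemma sum_follows m n (G : 'I_m -> R) :
  \sum_(f : {ffun 'I_n.+1 -> 'I_m} | follows f) weight y f * G (f ord_max) =
  \sum_(c < m) last_letter_sum n c * G c.
Proof.
elim: n G => [|n IHn] G.
  rewrite big_mkcond (sum_insert ord_max); apply: eq_bigr => c _.
  rewrite (eq_bigr (fun=> letter_weight y c * G c)) => [|f _].
    by rewrite sumr_const card_word0.
  rewrite insert_at weight_insert weight_word0 mulr1 ifT //.
  apply/forallP => i; apply/forallP => j; rewrite !ord1; exact/implyP.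
rewrite big_mkcond (sum_insert ord_max); apply: eq_bigr => c _.
under eq_bigr do rewrite follows_insert insert_at weight_insert.
transitivity (letter_weight y c * G c *
   \sum_(f : {ffun 'I_n.+1 -> 'I_m} | follows f)
     weight y f * (tie (d n) (f ord_max) c)%:R).
  rewrite mulr_sumr [RHS]big_mkcond; apply: eq_bigr => f _.
  case: (follows f) => //=; case: tie; last by rewrite !mulr0.
  by rewrite mulr1 mulrAC.
rewrite (IHn (fun b => (tie (d n) b c)%:R)) /= mulrAC; congr (_ * _ * _).
rewrite [RHS](big_ord_widen m
  (fun b => (tie (d n) b c)%:R * last_letter_sum n b)) //.
rewrite [RHS]big_mkcond; apply: eq_bigr => b _; rewrite mulrC.
by case: ltnP => // lt_cb; rewrite /tie; case: ltngtP lt_cb; rewrite ?mul0r // => *; lia.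
Qed.

Lemma last_letter_sum_even n c :
  last_letter_sum n.+1 c.*2 =
  y * (\sum_(b < c.*2) last_letter_sum n b
        + (d n)%:R * last_letter_sum n c.*2).
Proof.
rewrite /= /letter_weight odd_double big_ord_recr /= {2}/tie ltnn eqxx odd_double.
congr (_ * (_ + _)); apply: eq_bigr => b _.
by rewrite /tie ltn_ord mul1r.
Qed.

Lemma last_letter_sum_odd n c :
  last_letter_sum n.+1 c.*2.+1 =
  \sum_(b < c.*2) last_letter_sum n b + last_letter_sum n c.*2
    + (~~ d n)%:R * last_letter_sum n c.*2.+1.
Proof.
rewrite /= /letter_weight /= odd_double mul1r big_ord_recr big_ord_recr /=.
rewrite /tie ltnn eqxx /= odd_double ltnSn mul1r.
congr (_ + _ + _); apply: eq_bigr => b _.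
by rewrite ltnS ltnW // mul1r.
Qed.

Local Notation X := (fpsX R).
Local Notation Y := (fpsC y).
Let even_series n := Fps (fun c => last_letter_sum n c.*2).
Let odd_series n := Fps (fun c => last_letter_sum n c.*2.+1).
Definition total_series n : {fps R} :=
  Fps (fun k => \sum_(b < k.*2) last_letter_sum n b).

Lemma total_seriesE n : (1 - X) * total_series n = X * (even_series n + odd_series n).
Proof.
apply: fpsP => k; rewrite mulrBl mul1r fps_coefD fps_coefN !coefXM.
case: k => [|k] /=; first by rewrite big_ord0 subr0.
by rewrite doubleS !big_ord_recr /=; ring.
Qed.

Lemma even_seriesS n :
  even_series n.+1 = Y * (total_series n + (d n)%:R * even_series n).
Proof.
apply: fpsP => c; rewrite coefCM fps_coefD [LHS]last_letter_sum_even.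
by case: (d n); rewrite ?mul1r ?mul0r.
Qed.

Lemma odd_seriesS n :
  odd_series n.+1 =
  total_series n + even_series n + (~~ d n)%:R * odd_series n.
Proof.
apply: fpsP => c; rewrite !fps_coefD [LHS]last_letter_sum_odd.
by case: (d n); rewrite ?mul1r ?mul0r.
Qed.

(** Changing a last letter [b] that is odd to the even letter [b.-1] after a
descent or at the start, and to [b.+1] after an ascent, gives all sequences
ending in an even letter; hence one series determines the total. *)
Lemma even_odd_series n :
  even_series n =
  Y * (if (0 < n)%N && ~~ d n.-1 then X else 1) * odd_series n.
Proof.
case: n => [|n].
  apply: fpsP => c; rewrite mulr1 coefCM /= /letter_weight /= odd_double.
  by rewrite mulr1.
rewrite even_seriesS odd_seriesS /= -mulrA; case: (d n) => /=.
  by rewrite !mul1r mul0r addr0.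
congr (_ * _); rewrite mul0r addr0 mul1r -addrA mulrDr -total_seriesE; ring.
Qed.

(** The factor of a descent depends on the previous step, through
[even_odd_series]: a descent after an ascent makes a peak. *)
Lemma total_seriesS n : let T := total_series in
  if d n then
    if peak_word d n then (1 + Y * X) * ((1 - X) * T n.+1) = (1 + Y) ^+ 2 * X * T n
    else (1 - X) * T n.+1 = (Y + X) * T n
  else (1 - X) * T n.+1 = (1 + Y * X) * T n.
Proof.
move=> T; have := total_seriesE n; have := total_seriesE n.+1.
(* At a descent, even_odd_series turns X * (even + odd) into a multiple of
   X * odd, and total_seriesE turns it back into (1 - X) * total. *)
have := even_odd_series n; rewrite even_seriesS odd_seriesS /T /peak_word andbA.
case: (d n) => /= evE -> totE; rewrite ?mul1r ?mul0r ?andbT ?andbF.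
  move: evE totE; case: ifP => _ -> totE.
    transitivity (X * (1 + Y) * ((1 + Y * X) * total_series n
      + Y * (X * (Y * X * odd_series n + odd_series n)))); first by ring.
    by rewrite -totE; ring.
  transitivity (X * (1 + Y) * total_series n
      + Y * (X * (Y * 1 * odd_series n + odd_series n))); first by ring.
  by rewrite -totE; ring.
transitivity (X * (1 + Y) * total_series n
  + X * (even_series n + odd_series n)); first by ring.
by rewrite -totE; ring.
Qed.

Lemma total_series0 : (1 - X) ^+ 2 * total_series 0 = (1 + Y) * X.
Proof.
have := total_seriesE 0; rewrite even_odd_series /= mulr1 => totE.
rewrite expr2 -mulrA totE.
have -> : 1 + Y = (1 + Y) * ((1 - X) * odd_series 0); last by ring.
suff -> : (1 - X) * odd_series 0 = 1 by rewrite mulr1.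
apply: fpsP => c; rewrite mulrBl mul1r fps_coefD fps_coefN coefXM.
by case: c => [|c] /=; rewrite /letter_weight /= ?odd_double /= ?subr0 ?subrr.
Qed.

End Transfer.

(** * Closed form of the transfer series *)

Section RationalForm.
Variables (K : fieldType) (y : K).
Hypotheses (y_neq0 : y != 0%R) (y1_neq0 : (1 + y != 0)%R).
Local Open Scope ring_scope.
Local Notation X := (fpsX K).
Local Notation Y := (fpsC y).

Lemma unit_1subX : 1 - X \is a GRing.unit.
Proof. by rewrite fps_unitE fps_coefD fps_coefN /= subr0 unitr1. Qed.

Lemma unit_1addYX : 1 + Y * X \is a GRing.unit.
Proof. by rewrite fps_unitE fps_coefD fps_coef0M /= mulr0 addr0 unitr1. Qed.

Lemma unit_YaddX : Y + X \is a GRing.unit.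
Proof. by rewrite fps_unitE fps_coefD /= addr0 unitfE. Qed.

Lemma unit_1addY : 1 + Y \is a GRing.unit.
Proof. by rewrite fps_unitE fps_coefD /= unitfE. Qed.

Let peak_var : {fps K} := (1 + Y) ^+ 2 * X / ((Y + X) * (1 + Y * X)).
Let descent_var : {fps K} := (Y + X) / (1 + Y * X).

(** The index [n] counts adjacent pairs, so the permutations have length [n.+1].
The factor of an ascent occurs at every step, times [descent_var] at a descent
and times [peak_var] at a peak. *)
Lemma total_series_closed (d : nat -> bool) n :
  total_series y d n =
  1 / (1 + Y) * (((1 + Y * X) / (1 - X)) ^+ n.+2
    * (peak_var ^+ (\sum_(i < n) peak_word d i).+1
       * descent_var ^+ (\sum_(i < n) d i).+1)).
Proof.
have u1 := unit_1subX; have u2 := unit_1addYX.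
have u3 := unit_YaddX; have u4 := unit_1addY.
pose A' := (1 - X)^-1; pose B' := (1 + Y * X)^-1.
pose C' := (Y + X)^-1; pose D' := (1 + Y)^-1.
have eA : (1 - X) * A' = 1 by rewrite divrr.
have eB : (1 + Y * X) * B' = 1 by rewrite divrr.
have eC : (Y + X) * C' = 1 by rewrite divrr.
have eD : (1 + Y) * D' = 1 by rewrite divrr.
have peakE : peak_var = (1 + Y) ^+ 2 * X * (C' * B').
  by rewrite /peak_var invrM // [B' * C']mulrC.
have descE : descent_var = (Y + X) * B' by [].
elim: n => [|n IHn].
  rewrite !big_ord0 !expr1 peakE descE -/A' -/D'.
  have : A' ^+ 2 * ((1 - X) ^+ 2 * total_series y d 0) = A' ^+ 2 * ((1 + Y) * X).
    by rewrite total_series0.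
  have -> : A' ^+ 2 * ((1 - X) ^+ 2 * total_series y d 0) =
      ((1 - X) * A') ^+ 2 * total_series y d 0 by ring.
  rewrite eA expr1n mul1r => ->.
  transitivity (((1 + Y) * D') * ((1 + Y * X) * B') ^+ 2 * ((Y + X) * C')
                * (A' ^+ 2 * ((1 + Y) * X))); last by ring.
  by rewrite eB eC eD expr1n !mul1r.
have step : total_series y d n.+1 = (1 + Y * X) * A' *
   peak_var ^+ peak_word d n * descent_var ^+ d n * total_series y d n.
  have : total_series y d n.+1 = A' * ((1 - X) * total_series y d n.+1).
    by rewrite mulrA [A' * _]mulrC eA mul1r.
  have := total_seriesS y d n; rewrite /peak_word.
  case: (d n) => [|->] /=; last by move=> ->; rewrite !andbF !expr0; ring.
  rewrite andbT; case: ifP => _ /= totE ->.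
    have -> : (1 - X) * total_series y d n.+1 =
        B' * ((1 + Y * X) * ((1 - X) * total_series y d n.+1)).
      by rewrite mulrA [B' * _]mulrC eB mul1r.
    rewrite totE !expr1 peakE descE.
    transitivity (((1 + Y * X) * B') * ((Y + X) * C') *
      (A' * (B' * ((1 + Y) ^+ 2 * X * total_series y d n)))); last by ring.
    by rewrite eB eC !mul1r.
  rewrite totE expr1 expr0 descE.
  transitivity (((1 + Y * X) * B') * (A' * ((Y + X) * total_series y d n))).
    by rewrite eB mul1r.
  by ring.
rewrite step IHn !big_ord_recr /= -/A' -/D' -!addSn !exprD !exprS; ring.
Qed.

End RationalForm.

(** * Summation over permutations and over words *)

Lemma rmorph_word_sum (R S : comNzRingType) (f : {rmorphism R -> S})
    m (y z : R) c n :
  f (word_sum m y z c n) = word_sum m (f y) (f z) c n.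
Proof.
rewrite rmorph_sum; apply: eq_bigr => w _; rewrite rmorphM rmorphXn rmorph_prod.
congr (_ * _)%R; apply: eq_bigr => i _; rewrite /letter_weight.
by case: odd; rewrite ?rmorph1.
Qed.

Lemma rmorph_P_pk_des_fix (R S : comNzRingType) (f : {rmorphism R -> S})
    n (y t z : R) :
  f (P_pk_des_fix n y t z) = P_pk_des_fix n (f y) (f t) (f z).
Proof. by rewrite rmorph_sum; apply: eq_bigr => s _; rewrite !rmorphM !rmorphXn. Qed.

Lemma D_pk_des_P (R : comNzRingType) n (y t : R) :
  D_pk_des n y t = P_pk_des_fix n y t 0%R.
Proof.
rewrite /D_pk_des big_mkcond; apply: eq_bigr => s _; rewrite expr0n cards_eq0.
have -> : is_derangement s = ([set i | s i == i] == set0).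
  apply/forallP/eqP => [der|fix0 i].
    by apply/setP => i; rewrite !inE (negPf (der i)).
  by apply/negP => fix_i; have := in_set0 i; rewrite -fix0 inE fix_i.
by case: eqP => _; rewrite ?mulr1 ?mulr0.
Qed.

Section Assembly.
Variables (K : fieldType) (y z : K).
Hypotheses (y_neq0 : y != 0%R) (y1_neq0 : (1 + y != 0)%R).
Local Open Scope ring_scope.
Local Notation L := {fps K}.
Local Notation X := (fpsX K).
Local Notation w k n := (word_sum k.*2 y z k.*2 n).

Lemma compatible_descent_word m n (s : 'S_n.+1) (f : {ffun 'I_n.+1 -> 'I_m}) :
  compatible s f = follows (descent_word s) f.
Proof.
apply: eq_forallb => i; apply: eq_forallb => j.
by case: eqP => // ij; rewrite (descent_wordE s ij).
Qed.

Lemma compatible_sumE n (s : 'S_n.+1) k :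
  compatible_sum k.*2 y s = fps_coef (total_series y (descent_word s) n) k.
Proof.
transitivity (\sum_(c < k.*2) last_letter_sum y (descent_word s) n c * 1).
  rewrite -(@sum_follows _ y (descent_word s) k.*2 n (fun=> 1)).
  by apply: eq_big => f; [exact: compatible_descent_word | rewrite mulr1].
by apply: eq_bigr => c _; rewrite mulr1.
Qed.

(** Summed over permutations, the transfer series give back the words. *)
Lemma permutation_series n :
  1 / (1 + fpsC y) * (((1 + fpsC y * X) / (1 - X)) ^+ n.+2
     * P_pk_des_fix n.+1
         ((1 + fpsC y) ^+ 2 * X / ((fpsC y + X) * (1 + fpsC y * X)))
         ((fpsC y + X) / (1 + fpsC y * X)) (fpsC z))
  = Fps (fun k => w k n.+1).
Proof.
rewrite /P_pk_des_fix !mulr_sumr; apply: fpsP => k.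
rewrite fps_coef_sum [RHS]/= -sum_compatible_sum; apply: eq_bigr => s _.
rewrite compatible_sumE total_series_closed // -des_descent_word -pk_descent_word.
by rewrite !mulrA -rmorphXn mulrC coefCM mulrC.
Qed.

Local Notation Y2 := (fpsC (fpsC y)).
Local Notation Z2 := (fpsC (fpsC z)).
Local Notation t := (fpsC X).
Local Notation x := (fpsX L).

Lemma word_term k :
  (1 + Z2 * x * Y2) ^+ k / (1 - Z2 * x) ^+ k
    * ((1 - x) ^+ k / (1 + x * Y2) ^+ k) * (t ^+ k / (1 - k%:R * (1 + Y2) * x))
  = Fps (fun n => fpsC (w k n) : L) * t ^+ k.
Proof.
have unit1 (f : {fps L}) : 1 + f * x \is a GRing.unit.
  by rewrite fps_unitE fps_coefD fps_coef0M /= mulr0 addr0 unitr1.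
have unit1' (f : {fps L}) : 1 - f * x \is a GRing.unit by rewrite -mulNr.
have -> : Fps (fun n => fpsC (w k n) : L) =
    Fps (word_sum k.*2 (fpsC y : L) (fpsC z) k.*2).
  by apply: fpsP => n; rewrite /= rmorph_word_sum.
apply: solve_unit_factors; rewrite ?unitrX ?unit1 ?unit1' //.
  by rewrite [x * Y2]mulrC unit1.
rewrite [x * Y2]mulrC [Z2 * x * Y2]mulrAC.
have := word_series (fpsC y : L) (fpsC z) k.
by rewrite !(rmorphM, rmorphD, rmorph1, rmorph_nat).
Qed.

Lemma sum_x_powers (A : nat -> L) :
  fps2_has_sum 1 (fun n => fpsC (A n) * x ^+ n)
    (Fps (fun n => if n is 0 then 0 else A n)).
Proof.
move=> i j; exists i.+1 => n lt_in; rewrite /fps2_coef fps_coef_sum.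
have coef_term k : fps_coef (fpsC (A k) * x ^+ k) i = if i == k then A k else 0.
  by rewrite coefMXn; case: ltngtP => //= [|->]; rewrite ?subnn // -subn_gt0; case: subn.
under eq_bigr do rewrite coef_term.
case: i lt_in coef_term => [|i] lt_in _ /=.
  by rewrite big_nat_cond big1 // => -[|k].
congr (fps_coef _ j); rewrite (bigD1_seq i.+1) ?mem_index_iota ?iota_uniq //=.
by rewrite eqxx big1 ?addr0 // => k /negPf; rewrite eq_sym => ->.
Qed.

(** Only the term of index [j] contributes to the coefficient of [t ^ j]. *)
Lemma sum_t_powers (a : nat -> nat -> K) :
  fps2_has_sum 0 (fun k => Fps (fun n => fpsC (a k n) : L) * t ^+ k)
    (Fps (fun n => Fps (fun k => a k n))).
Proof.
move=> i j; exists j.+1 => n lt_jn; rewrite /fps2_coef !fps_coef_sum.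
have coef_term k : fps_coef (fps_coef
    (Fps (fun n => fpsC (a k n) : L) * t ^+ k) i) j = if j == k then a k i else 0.
  rewrite -rmorphXn mulrC coefCM mulrC coefMXn /=.
  by case: ltngtP => //= [|->]; rewrite ?subnn // -subn_gt0; case: subn.
under eq_bigr do rewrite coef_term.
rewrite (bigD1_seq j) ?mem_index_iota ?iota_uniq //=.
by rewrite eqxx big1 ?addr0 // => k /negPf; rewrite eq_sym => ->.
Qed.

(** Keeping [z] an arbitrary constant makes the two parts of the theorem the
instances where it is the variable and where it is 0. *)
Lemma pk_des_fix_series :
  exists SL SR : {fps L},
    [/\ fps2_has_sum 1
          (fun n => ((1 + Y2 * t) / (1 - t)) ^+ n.+1
             * P_pk_des_fix n ((1 + Y2) ^+ 2 * t / ((Y2 + t) * (1 + Y2 * t)))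
                              ((Y2 + t) / (1 + Y2 * t)) Z2
             * x ^+ n)
          SL,
        fps2_has_sum 0
          (fun k => (1 + Z2 * x * Y2) ^+ k / (1 - Z2 * x) ^+ k
             * ((1 - x) ^+ k / (1 + x * Y2) ^+ k)
             * (t ^+ k / (1 - k%:R * (1 + Y2) * x)))
          SR
      & 1 / (1 - t) + 1 / (1 + Y2) * SL = SR].
Proof.
have u1 := unit_1subX K; have u2 := unit_1addYX y.
have u3 := unit_YaddX y_neq0; have u4 := unit_1addY y1_neq0.
pose A n : L := ((1 + fpsC y * X) / (1 - X)) ^+ n.+1
     * P_pk_des_fix n
         ((1 + fpsC y) ^+ 2 * X / ((fpsC y + X) * (1 + fpsC y * X)))
         ((fpsC y + X) / (1 + fpsC y * X)) (fpsC z).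
exists (Fps (fun n => if n is 0 then 0 else A n)).
exists (Fps (fun n => Fps (fun k => w k n))); split.
- apply: eq_fps2_has_sum (sum_x_powers A) => n; congr (_ * _).
  rewrite rmorphM rmorph_P_pk_des_fix rmorphXn.
  have t1 : fpsC ((1 + fpsC y * X) / (1 - X)) = (1 + Y2 * t) / (1 - t).
    by rewrite (rmorph_div _ _ u1) rmorphD rmorphM rmorphB rmorph1.
  have t2 : fpsC ((fpsC y + X) / (1 + fpsC y * X)) = (Y2 + t) / (1 + Y2 * t).
    by rewrite (rmorph_div _ _ u2) !rmorphD rmorphM rmorph1.
  have t3 : fpsC ((1 + fpsC y) ^+ 2 * X / ((fpsC y + X) * (1 + fpsC y * X))) =
      (1 + Y2) ^+ 2 * t / ((Y2 + t) * (1 + Y2 * t)).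
    have u32 : (fpsC y + X) * (1 + fpsC y * X) \is a GRing.unit.
      by rewrite unitrM u3.
    rewrite (rmorph_div _ _ u32) rmorphM rmorphXn rmorphD rmorph1.
    by rewrite rmorphM !rmorphD rmorphM rmorph1.
  by rewrite /= t1 t2 t3.
- by apply: eq_fps2_has_sum (sum_t_powers _) => k; rewrite word_term.
have -> : 1 / (1 - t) = fpsC (1 / (1 - X)) by rewrite (rmorph_div _ _ u1) rmorphB rmorph1.
have -> : 1 / (1 + Y2) = fpsC (1 / (1 + fpsC y)) by rewrite (rmorph_div _ _ u4) rmorphD rmorph1.
apply: fpsP => n; rewrite fps_coefD coefCM.
case: n => [|n] /=; last by rewrite add0r permutation_series.
rewrite mulr0 addr0 mul1r.
have -> : Fps (fun k => w k 0) = Fps (fun=> 1) by apply: fpsP => k /=; rewrite word_sum_n0.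
apply: (mulrI u1); rewrite mulrV //; apply: fpsP => k.
rewrite mulrBl mul1r fps_coefD fps_coefN coefXM.
by case: k => [|k] /=; rewrite ?subr0 ?subrr.
Qed.

End Assembly.

Local Open Scope ring_scope.

Theorem theorem6p1 :
  let x := var_x in let y := var_y in let t := var_t in let z := var_z in
  (* (a) *)
  (exists SL SR : Qyz_xt,
    [/\ fps2_has_sum 1
          (fun n => ((1 + y * t) / (1 - t)) ^+ n.+1
             * P_pk_des_fix n ((1 + y) ^+ 2 * t / ((y + t) * (1 + y * t)))
                              ((y + t) / (1 + y * t)) z
             * x ^+ n)
          SL,
        fps2_has_sum 0
          (fun k => (1 + z * x * y) ^+ k / (1 - z * x) ^+ k
             * ((1 - x) ^+ k / (1 + x * y) ^+ k)
             * (t ^+ k / (1 - k%:R * (1 + y) * x)))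
          SR
      & 1 / (1 - t) + 1 / (1 + y) * SL = SR])
  /\
  (* (b) *)
  (exists SL SR : Qyz_xt,
    [/\ fps2_has_sum 1
          (fun n => ((1 + y * t) / (1 - t)) ^+ n.+1
             * D_pk_des n ((1 + y) ^+ 2 * t / ((y + t) * (1 + y * t)))
                          ((y + t) / (1 + y * t))
             * x ^+ n)
          SL,
        fps2_has_sum 0
          (fun k => (1 - x) ^+ k / (1 + x * y) ^+ k
             * (t ^+ k / (1 - k%:R * (1 + y) * x)))
          SR
      & 1 / (1 - t) + 1 / (1 + y) * SL = SR]).
Proof.
pose y0 : Qyz := tofrac 'X%:P; pose z0 : Qyz := tofrac 'X.
have y_neq0 : y0 != 0 by rewrite tofrac_eq0 polyC_eq0 polyX_eq0.
have y1_neq0 : 1 + y0 != 0.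
  rewrite -tofrac1 -tofracD tofrac_eq0 -polyC1 -polyCD polyC_eq0 addrC.
  by rewrite -polyC1 monic_neq0 // monicXaddC.
split; first exact: (pk_des_fix_series z0 y_neq0 y1_neq0).
have := pk_des_fix_series 0 y_neq0 y1_neq0.
have -> : fpsC (fpsC 0) = 0 :> Qyz_xt by rewrite !rmorph0.
case=> SL [SR [sumL sumR eqLR]]; exists SL, SR; split; last exact: eqLR.
  by apply: eq_fps2_has_sum sumL => n; rewrite D_pk_des_P.
apply: eq_fps2_has_sum sumR => k.
by rewrite !mul0r subr0 addr0 expr1n divr1 mul1r.
Qed.
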